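(* Let $\Gamma<\operatorname{SL}_2(\mathbb{R})$ be a cofinite Fuchsian group with the standing normalization below, $M=\Gamma\backslash\mathbb{H}$ of finite area $V$. If the Rademacher symbol $\Psi$ is rational-valued, then there exists $k\in2\mathbb{N}$ such that $$\operatorname{ind}(\widetilde\triangle_k(C),0)=\frac{kV}{4\pi}\Psi(C)$$ for every prime geodesic $C$ on $M$.
   Context: A cofinite Fuchsian group is a discrete $\Gamma<\operatorname{SL}_2(\mathbb{R})$ with $\Gamma\backslash\mathbb{H}$ noncompact of finite area $V$; normalized so that $\infty$ is a cusp with stabilizer generated by $\begin{pmatrix}1&1\\0&1\end{pmatrix}$ (and $-I$ if $-I\in\Gamma$). $j(g,z)=cz+d$; principal branch of $\log$. $f(z)=iz+\sum_{n\ge1}c(n)e^{2\pi inz}$ is the holomorphic function attached to the cusp $\infty$ (Burrin's construction from Kronecker's first limit formula), real coefficients of polynomial growth, such that $\Phi(\gamma)=\frac1i(f(\gamma z)-f(z)-V^{-1}\operatorname{sign}(c)^2\log(-j(\gamma,z)^2))$ is real and independent of $z$; $\Psi(\gamma)=\Phi(\gamma)-\pi V^{-1}\operatorname{sign}(c(a+d))$ for $\gamma=\begin{pmatrix}a&b\\c&d\end{pmatrix}\in\Gamma$. For $k\in2\mathbb{N}$ put $\triangle_k(z)=e^{kVf(z)/2}$ and $\widetilde\triangle_k(g)=\triangle_k(gi)j(g,i)^{-k}$ on $\operatorname{SL}_2(\mathbb{R})$. A prime geodesic $C$ on $M$ is a primitive closed oriented geodesic; it corresponds to the conjugacy class of a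 primitive hyperbolic $\gamma\in\Gamma$ with positive trace, and $\Psi(C):=\Psi(\gamma)$. $\operatorname{ind}(\widetilde\triangle_k(C),0)=\frac1{2\pi i}\int_C d\widetilde\triangle_k/\widetilde\triangle_k$, integrated along the geodesic-flow orbit in $\operatorname{SL}_2(\mathbb{R})$ from a point $g$ to $\gamma g$ lifting $C$. *)

(* Defs.v *)
From HB Require Import structures.
From mathcomp Require Import all_boot all_order all_algebra.
From mathcomp Require Import all_classical all_reals all_analysis.
From mathcomp Require Import complex.

Set Implicit Arguments.
Unset Strict Implicit.
Unset Printing Implicit Defensive.

Import Order.TTheory GRing.Theory Num.Theory.
Import numFieldNormedType.Exports.

Local Open Scope classical_set_scope.
Local Open Scope ring_scope.
Local Open Scope complex_scope.

Section Complex.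
Context {R : realType}.
Implicit Types (x : R) (z : R[i]).

Definition cabs z : R := Num.sqrt (complex.Re z ^+ 2 + complex.Im z ^+ 2).

Definition cexp z : R[i] :=
  (expR (complex.Re z))%:C * (cos (complex.Im z) +i* sin (complex.Im z)).

(* Principal argument, with values in ]-pi, pi]; the value at 0 is junk. *)
Definition carg z : R :=
  let t := acos (complex.Re z / cabs z) in
  if 0 <= complex.Im z then t else - t.

Definition clog z : R[i] := ln (cabs z) +i* carg z.

Definition upper_half_plane : set R[i]^o := [set z | 0 < complex.Im z].

(* Derivative and integral of a complex-valued function of a real variable. *)
Definition cderive (w : R -> R[i]) (t : R) : R[i] :=
  derive1 (fun u => complex.Re (w u)) t +i* derive1 (fun u => complex.Im (w u)) t.

Definition cintegral (a b : R) (h : R -> R[i]) : R[i] :=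
  (\int[lebesgue_measure]_(t in `[a, b]) complex.Re (h t))%R
  +i* (\int[lebesgue_measure]_(t in `[a, b]) complex.Im (h t))%R.

End Complex.

Section SL2.
Context {R : realType}.
Implicit Types (g h : 'M[R]_2) (z : R[i]) (G : set 'M[R]_2).

Definition jfactor g z : R[i] := (g 1 0)%:C * z + (g 1 1)%:C.

Definition mobius g z : R[i] := ((g 0 0)%:C * z + (g 0 1)%:C) / jfactor g z.

(* [[1, n], [0, 1]] *)
Definition translation (n : int) : 'M[R]_2 := 1%:M + n%:~R *: delta_mx 0 1.

Definition discrete_subgroup G : Prop :=
  [/\ forall g, G g -> \det g = 1,
      G 1%:M,
      forall g h, G g -> G h -> G (g *m h),
      forall g, G g -> G (invmx g) &
      forall g, G g -> \forall h \near g, G h -> h = g].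

Definition stabilizer_oo G : set 'M[R]_2 := [set g | G g /\ g 1 0 = 0].

(* The group generated by translation 1, together with -I when -I is in G. *)
Definition normalized_cusp_oo G : Prop :=
  stabilizer_oo G = [set g | (exists n : int, g = translation n) \/
                             (G (- 1%:M) /\ exists n : int, g = - translation n)].

(* Compactness of G\H for the quotient topology: the open sets of the quotient
   are the traces on H of the open sets that are stable under G. *)
Definition compact_quotient G : Prop :=
  forall (I : choiceType) (D : set I) (U : I -> set R[i]^o),
    (forall i, D i -> open (U i) /\
       forall g z, G g -> upper_half_plane z -> U i z -> U i (mobius g z)) ->
    upper_half_plane `<=` cover D U ->
    finite_subset_cover D U upper_half_plane.

(* F meets each G-orbit in H exactly once. *)
Definition fundamental_set G (F : set (R * R)) : Prop :=
  (forall p, F p -> 0 < p.2) /\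
  (forall z, upper_half_plane z ->
     exists! p, F p /\ exists2 g, G g & mobius g z = p.1 +i* p.2).

Definition hyperbolic_area (F : set (R * R)) : \bar R :=
  (\int[(@lebesgue_measure R) \x (@lebesgue_measure R)]_(p in F)
     ((p.2 ^+ 2)^-1)%:E)%E.

(* V is the (finite) hyperbolic area of G\H. *)
Definition covolume G (V : R) : Prop :=
  0 < V /\
  exists F : set (R * R),
    [/\ measurable F, fundamental_set G F & hyperbolic_area F = V%:E].

Definition cofinite_fuchsian G (V : R) : Prop :=
  [/\ discrete_subgroup G, ~ compact_quotient G, covolume G V &
      normalized_cusp_oo G].

(* Right cosets of the stabilizer of oo. *)
Definition cosets_oo G : set (set 'M[R]_2) :=
  [set A | exists2 g, G g & A = [set h *m g | h in stabilizer_oo G]].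

(* Eisenstein series of the cusp oo, for real s > 1; the summand is constant
   on each coset, and is evaluated at a chosen element of it. *)
Definition eisenstein G z (s : R) : R :=
  fine (\esum_(A in cosets_oo G)
          ((complex.Im (mobius (xget 1%:M A) z)) `^ s)%:E)%E.

End SL2.

Section Rademacher.
Context {R : realType}.
Variables (V : R) (f : R[i]^o -> R[i]^o).
Implicit Types (g : 'M[R]_2) (z : R[i]) (G : set 'M[R]_2).

Definition PhiC g z : R[i] :=
  'i%C^-1 * (f (mobius g z) - f z
           - (V^-1 * Num.sg (g 1 0) ^+ 2)%:C * clog (- jfactor g z ^+ 2)).

(* For the functions f below, PhiC g z is real and does not depend on z. *)
Definition Phi g : R := complex.Re (PhiC g 'i%C).

Definition Psi g : R :=
  Phi g - pi * V^-1 * Num.sg (g 1 0 * (g 0 0 + g 1 1)).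

Definition fourier_expansion (c : nat -> R[i]) : Prop :=
  forall z, upper_half_plane z ->
    ((fun N : nat => 'i%C * z + \sum_(1 <= n < N)
        c n * cexp ((2 * pi * n%:R)%:C * 'i%C * z)) : nat -> R[i]^o) @ \oo --> f z.

Definition polynomial_growth (c : nat -> R[i]) : Prop :=
  exists (A : R) (K : nat), forall n : nat, (0 < n)%N ->
    cabs (c n) <= A * n%:R ^+ K.

(* The harmonic function Re f is singled out by the first Kronecker limit
   formula for the cusp oo,
     E(z, s) = V^-1 / (s - 1) + C - V^-1 log (Im z) - Re f(z) + o(1), s -> 1;
   the Fourier expansion has no constant term, which then fixes f. *)
Definition kronecker_limit G : Prop :=
  exists C : R, forall z, upper_half_plane z ->
    (eisenstein G z s - V^-1 / (s - 1)) @[s --> 1^'+] -->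
      C - V^-1 * ln (complex.Im z) - complex.Re (f z).

Definition cusp_function G : Prop :=
  [/\ forall z, upper_half_plane z -> derivable f z 1,
      exists2 c : nat -> R[i], polynomial_growth c & fourier_expansion c,
      kronecker_limit G &
      forall g z, G g -> upper_half_plane z -> PhiC g z = (Phi g)%:C].

Definition triangle (k : nat) z : R[i] := cexp ((k%:R * V / 2)%:C * f z).

Definition triangle_lift (k : nat) g : R[i] :=
  triangle k (mobius g 'i%C) * jfactor g 'i%C ^- k.

End Rademacher.

Section Geodesics.
Context {R : realType}.
Implicit Types (g gamma : 'M[R]_2) (G : set 'M[R]_2).

(* Primitive hyperbolic elements of positive trace; their conjugacy classes
   in G are the prime geodesics. *)
Definition prime_hyperbolic G gamma : Prop :=
  [/\ G gamma, 2 < `|\tr gamma|, 0 < \tr gamma &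
      forall h (n : nat), G h -> (1 < n)%N -> gamma <> h ^+ n].

(* The geodesic flow is right multiplication by diag(e^(t/2), e^(-t/2)). *)
Definition geodesic_flow g (t : R) : 'M[R]_2 :=
  g *m (expR (t / 2) *: delta_mx 0 0 + expR (- t / 2) *: delta_mx 1 1).

(* The flow orbit of g on [0, l] runs from g to gamma g. *)
Definition geodesic_lift gamma g (l : R) : Prop :=
  [/\ \det g = 1, 0 < l & geodesic_flow g l = gamma *m g].

(* 1/(2 pi i) times the integral of dF/F along the flow orbit of g on [0, l] *)
Definition index_along (F : 'M[R]_2 -> R[i]) g (l : R) : R[i] :=
  ((2 * pi)%:C * 'i%C)^-1 *
  cintegral 0 l (fun t => let w := fun u => F (geodesic_flow g u) in
                          cderive w t / w t).

End Geodesics.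

(* Main.v *)
(* The value k = 2 works. Along the flow orbit of g write z(t) = g a_t i and
   j(t) = j(g a_t, i). The product p(t) of j(t) with the conjugate of j(0) stays
   in the right half-plane, so that the lift of triangle_2 along the orbit is a
   constant times exp (V f(z(t)) - 2 Log p(t)), with Log the principal branch,
   and the index is 1/(2 pi i) times the increment of this exponent. As
   p(l) / p(0) = j(gamma, z(0)) =: J, the transformation law of f and the identity
   log (- J^2) = 2 Log J - i pi sign (Im J) turn the increment into
   i (V Phi(gamma) - pi sign c) = i V Psi(gamma).
   To integrate the logarithmic derivative one needs f' to be continuous: the
   second differences of e(nz) factor as e(nz) (e(nh) - 1) (e(nw) - 1), and
   summing them against the Fourier coefficients shows that f' is locally
   Lipschitz. *)

Require Import Defs.
From HB Require Import structures.
From mathcomp Require Import all_boot all_order all_algebra.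
From mathcomp Require Import all_classical all_reals all_analysis.
From mathcomp Require Import complex.
From mathcomp Require Import ring lra.

Set Implicit Arguments.
Unset Strict Implicit.
Unset Printing Implicit Defensive.

Import Order.TTheory GRing.Theory Num.Theory.
Import numFieldNormedType.Exports.
Local Open Scope classical_set_scope.
Local Open Scope ring_scope.
Local Open Scope complex_scope.

(** * Real-valued modulus on [R[i]], and growth of the complex exponential near 0 *)

Section Cabs.
Context {R : realType}.
Implicit Types (z u : R[i]).

Lemma ImD z u : complex.Im (z + u) = complex.Im z + complex.Im u.
Proof. by case: z u => ? ? []. Qed.

Lemma normr_cabs z : `|z| = (cabs z)%:C.
Proof. by rewrite normc_def. Qed.

Lemma cabs_ge0 z : 0 <= cabs z.
Proof. exact: sqrtr_ge0. Qed.

Lemma cabsM z u : cabs (z * u) = cabs z * cabs u.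
Proof. by apply: complexI; rewrite rmorphM /= -!normr_cabs normrM. Qed.

Lemma cabsD z u : cabs (z + u) <= cabs z + cabs u.
Proof. by rewrite -lecR rmorphD /= -!normr_cabs ler_normD. Qed.

Lemma cabs0 : cabs (0 : R[i]) = 0.
Proof. by apply: complexI; rewrite -!normr_cabs normr0. Qed.

Lemma cabs_real (x : R) : cabs x%:C = `|x|.
Proof. by rewrite /cabs /= expr0n addr0 sqrtr_sqr. Qed.

Lemma cabs_i : cabs ('i%C : R[i]) = 1.
Proof. by rewrite /cabs /= expr0n add0r expr1n sqrtr1. Qed.

Lemma cabsV z : cabs z^-1 = (cabs z)^-1.
Proof. by apply: complexI; rewrite fmorphV /= -!normr_cabs normfV. Qed.

Lemma cabs_eq0 z : (cabs z == 0) = (z == 0).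
Proof. by rewrite -(normr_eq0 (z : R[i])) normc_def -(inj_eq (@complexI R)). Qed.

Lemma cabs_sum (I : Type) (s : seq I) (F : I -> R[i]) :
  cabs (\sum_(i <- s) F i) <= \sum_(i <- s) cabs (F i).
Proof.
elim/big_ind2 : _ => //; first by rewrite cabs0.
by move=> z x u y hz hu; apply: le_trans (cabsD _ _) _; exact: lerD.
Qed.

Lemma Re_le_cabs z : `|complex.Re z| <= cabs z.
Proof. by rewrite -sqrtr_sqr ler_wsqrtr// lerDl sqr_ge0. Qed.

Lemma Im_le_cabs z : `|complex.Im z| <= cabs z.
Proof. by rewrite -sqrtr_sqr ler_wsqrtr// lerDr sqr_ge0. Qed.

Lemma cabs_le z : cabs z <= `|complex.Re z| + `|complex.Im z|.
Proof.
rewrite -(ger0_norm (addr_ge0 (normr_ge0 _) (normr_ge0 _))) -sqrtr_sqr.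
apply: ler_wsqrtr; rewrite sqrrD !real_normK ?num_real//.
by rewrite lerD2r lerDl mulrn_wge0// mulr_ge0.
Qed.

(** Mean value theorem on the segment between 0 and [a], once for each sign of [a]. It serves the
    bounds on [sin] and on [cos - 1]. *)
Lemma lipschitz1 (f df : R -> R) (a : R) :
  (forall x : R, is_derive x 1 f (df x)) -> (forall x, `|df x| <= 1) ->
  `|f a - f 0| <= `|a|.
Proof.
move=> fE dfE.
have cf : continuous f.
  by move=> x; apply: differentiable_continuous; apply/derivable1_diffP/ex_derive.
have [a0|a0] := leP 0 a.
  have [|c _ ->] := MVT_segment a0 (fun x _ => fE x).
    exact: continuous_subspaceT.
  by rewrite subr0 normrM ler_piMl.
have [|c _ E] := MVT_segment (ltW a0) (fun x _ => fE x).
  exact: continuous_subspaceT.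
by rewrite distrC E sub0r normrM normrN ler_piMl.
Qed.

Lemma sin_le_norm (x : R) : `|sin x| <= `|x|.
Proof.
rewrite -[sin x]subr0 -sin0; apply: (lipschitz1 (df := cos)) => y.
by rewrite ler_norml cos_geN1 cos_le1.
Qed.

Lemma cosB1_le_norm (x : R) : `|cos x - 1| <= `|x|.
Proof.
rewrite -[1]cos0; apply: (lipschitz1 (df := fun x => - sin x)) => y.
by rewrite normrN sin_max.
Qed.

(** Both signs come from 1 - e^(-y) <= y: for x >= 0 take y = x and multiply by e^x; for x < 0 take
    y = -x and enlarge the right-hand side by the factor e^|x| >= 1. *)
Lemma expRB1_le (x : R) : `|expR x - 1| <= `|x| * expR `|x|.
Proof.
have h (y : R) : 1 - expR (- y) <= y by have := expR_ge1Dx (- y); lra.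
have [x0|x0] := leP 0 x.
  have e1 : 1 <= expR x by rewrite -expR0 ler_expR.
  rewrite (ger0_norm x0) ger0_norm ?subr_ge0//.
  have := ler_wpM2r (expR_ge0 x) (h x).
  by rewrite mulrBl -expRD addNr expR0 mul1r.
have e1 : expR x <= 1 by rewrite -expR0 ler_expR ltW.
rewrite distrC (ltr0_norm x0) ger0_norm ?subr_ge0//.
apply: le_trans (_ : - x <= _); first by have := h (- x); rewrite opprK.
have x1 : 0 <= - x by rewrite oppr_ge0 ltW.
by apply: ler_peMr => //; rewrite -expR0 ler_expR.
Qed.

Lemma cexpD z u : cexp (z + u) = cexp z * cexp u.
Proof.
case: z u => [a b] [c d]; rewrite /cexp /= cosD sinD expRD.
by apply/eqP; rewrite eq_complex /=; apply/andP; split; apply/eqP; ring.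
Qed.

Lemma cexp0 : cexp (0 : R[i]) = 1.
Proof. by rewrite /cexp /= expR0 cos0 sin0 mul1r. Qed.

Lemma cexp_neq0 z : cexp z != 0.
Proof.
apply/negP => /eqP h; have := cexpD z (- z); rewrite h mul0r subrr cexp0.
by move/eqP; rewrite oner_eq0.
Qed.

Lemma cexpN z : cexp (- z) = (cexp z)^-1.
Proof.
apply: (mulfI (cexp_neq0 z)); rewrite mulfV ?cexp_neq0//.
by rewrite -cexpD subrr cexp0.
Qed.

Lemma cexpMn z n : cexp (z *+ n) = cexp z ^+ n.
Proof. by elim: n => [|n ih]; rewrite ?cexp0// mulrS cexpD ih exprS. Qed.

Lemma cabs_cexp z : cabs (cexp z) = expR (complex.Re z).
Proof.
rewrite cabsM cabs_real ger0_norm ?expR_ge0//.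
by rewrite {1}/cabs /= cos2Dsin2 sqrtr1 mulr1.
Qed.

(** With z = x + iy, the factor 3 counts the terms e^x (cos y - 1), e^x - 1 and e^x sin y, each of
    which is at most |z| e^|z| in absolute value. *)
Lemma cexpB1_le z : cabs (cexp z - 1) <= 3 * cabs z * expR (cabs z).
Proof.
have e (x : R) : `|x| <= cabs z -> `|x| <= cabs z * expR (cabs z).
  move=> h; apply: le_trans h _.
  by rewrite ler_peMr ?cabs_ge0// -expR0 ler_expR cabs_ge0.
have hx := Re_le_cabs z; have hy := Im_le_cabs z.
have Ex : expR (complex.Re z) <= expR (cabs z).
  by rewrite ler_expR (le_trans (ler_norm _)).
have f (x : R) : `|x| <= `|complex.Im z| ->
    `|expR (complex.Re z) * x| <= cabs z * expR (cabs z).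
  move=> h; rewrite normrM ger0_norm ?expR_ge0// mulrC.
  by apply: ler_pM; rewrite ?normr_ge0 ?expR_ge0// (le_trans h).
apply: le_trans (cabs_le _) _.
have -> : complex.Re (cexp z - 1) = expR (complex.Re z) * (cos (complex.Im z) - 1)
    + (expR (complex.Re z) - 1) by rewrite /cexp /=; ring.
have -> : complex.Im (cexp z - 1) = expR (complex.Re z) * sin (complex.Im z).
  by rewrite /cexp /=; ring.
have h1 := f _ (cosB1_le_norm _); have h2 := f _ (sin_le_norm _).
have h3 : `|expR (complex.Re z) - 1| <= cabs z * expR (cabs z).
  apply: le_trans (expRB1_le _) _.
  by apply: ler_pM; rewrite ?normr_ge0 ?expR_ge0 ?ler_expR.
rewrite -mulrA; have := ler_normD (expR (complex.Re z) * (cos (complex.Im z) - 1))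
  (expR (complex.Re z) - 1).
lra.
Qed.

End Cabs.

(** * Estimates for the modes e(nz) and for the sums that majorize the Fourier series *)

Section Fourier.
Context {R : realType}.
Implicit Types (z h w : R[i]).

(** Comparison with a telescoping series: the Taylor term of order m + 2 of e^(na) gives n^m e^(-na)
    <= C / n^2 with C = (m + 2)! / a^(m + 2). *)
Lemma sum_natM_expRN_bounded (m : nat) (a : R) : 0 < a ->
  exists B : R, forall N : nat,
    \sum_(1 <= n < N) n%:R ^+ m * expR (- (n%:R * a)) <= B.
Proof.
move=> a0; pose C : R := (m.+2)`!%:R / a ^+ m.+2.
have C0 : 0 <= C by rewrite divr_ge0// exprn_ge0// ltW.
(* The 2 comes from n + 1 <= 2n, that is, 1 / n^2 <= 2 / (n (n + 1)). *)
have term (n : nat) : (0 < n)%N ->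
    n%:R ^+ m * expR (- (n%:R * a)) <= 2 * C * (n%:R^-1 - n.+1%:R^-1).
  move=> n0; have n0' : 0 < n%:R :> R by rewrite ltr0n.
  have n1 : 1 <= n%:R :> R by rewrite ler1n.
  have na0 : 0 <= n%:R * a by rewrite mulr_ge0// ltW.
  have f0 : 0 < (m.+2)`!%:R :> R by rewrite ltr0n fact_gt0.
  have am0 : 0 < a ^+ m.+2 by rewrite exprn_gt0.
  have h1 : n%:R ^+ m.+2 * expR (- (n%:R * a)) <= C.
    rewrite expRN ler_pdivrMr ?expR_gt0// /C -mulrA mulrC -ler_pdivrMr//.
    rewrite mulrC ler_pdivlMl//.
    have := @expR_ge1Dxn R (n%:R * a) m.+1 na0.
    rewrite exprMn => h; apply: le_trans h.
    set q := (_%:R)^-1; set b := a ^+ _; set c := _ ^+ _; have -> : b * (q * c) = c * b * q by ring.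
    by rewrite lerDr.
  have -> : n%:R ^+ m * expR (- (n%:R * a))
          = (n%:R ^+ m.+2 * expR (- (n%:R * a))) / n%:R ^+ 2.
    by rewrite -[m.+2]addn2 exprD mulrAC mulfK// expf_neq0// gt_eqF.
  apply: le_trans (_ : C / n%:R ^+ 2 <= _).
    by rewrite ler_pM2r// invr_gt0 exprn_gt0.
  rewrite (mulrC 2 C) -[leRHS]mulrA ler_wpM2l//.
  have -> : n%:R^-1 - n.+1%:R^-1 = (n%:R * n.+1%:R)^-1 :> R.
    have nz : n%:R + 1 != 0 :> R by lra.
    have nz' : n%:R != 0 :> R by lra.
    by rewrite -natr1; field; rewrite nz nz'.
  rewrite -[leLHS]mul1r ler_pdivrMr ?exprn_gt0// mulrAC ler_pdivlMr ?mulr_gt0//.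
  rewrite mul1r -natr1 expr2; nra.
exists (2 * C) => N; have [N1|N1] := leqP N 1.
  by rewrite big_geq// mulr_ge0.
apply: le_trans (_ : \sum_(1 <= n < N) 2 * C * (n%:R^-1 - n.+1%:R^-1) <= _).
  by rewrite big_nat [leRHS]big_nat; apply: ler_sum => n /andP[n0 _]; exact: term.
rewrite -mulr_sumr (@telescope_sumr_eq _ _ _ (fun n => - n%:R^-1) _ (ltnW N1)); last first.
  by move=> n _; rewrite opprK addrC.
rewrite -[leRHS]mulr1 ler_wpM2l//; first by rewrite mulr_ge0.
rewrite opprK invr1 addrC.
by rewrite gerDl oppr_le0 invr_ge0.
Qed.

Definition fourier_mode (n : nat) z : R[i] :=
  cexp ((2 * pi * n%:R)%:C * 'i%C * z).

Lemma fourier_modeD n z w :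
  fourier_mode n (z + w) = fourier_mode n z * fourier_mode n w.
Proof. by rewrite /fourier_mode mulrDr cexpD. Qed.

Lemma cabs_fourier_mode n z :
  cabs (fourier_mode n z) = expR (- (2 * pi * n%:R * complex.Im z)).
Proof. by case: z => x y; rewrite cabs_cexp /=; congr expR; ring. Qed.

Lemma fourier_modeB1_le n h :
  cabs (fourier_mode n h - 1)
    <= 3 * (2 * pi * n%:R * cabs h) * expR (2 * pi * n%:R * cabs h).
Proof.
have p0 : 0 <= 2 * pi * n%:R :> R by rewrite !mulr_ge0// pi_ge0.
have E : cabs ((2 * pi * n%:R)%:C * 'i%C * h) = 2 * pi * n%:R * cabs h.
  by rewrite !cabsM cabs_real cabs_i mulr1 ger0_norm.
by have := cexpB1_le ((2 * pi * n%:R)%:C * 'i%C * h); rewrite E.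
Qed.

(** Each factor e(nu) - 1 with |u| <= y/4, y = Im z, costs at most 6 pi n |u| e^(pi n y / 2). The
    two of them use up half of the decay e^(-2 pi n y) of e(nz) and leave e^(-pi n y); the constant
    36 pi^2 is (6 pi)^2. *)
Lemma fourier_mode_second_difference n z h w :
  cabs h <= complex.Im z / 4 -> cabs w <= complex.Im z / 4 ->
  cabs (fourier_mode n (z + w + h) - fourier_mode n (z + w)
        - (fourier_mode n (z + h) - fourier_mode n z))
  <= 36 * pi ^+ 2 * n%:R ^+ 2 * expR (- (n%:R * (pi * complex.Im z)))
     * (cabs h * cabs w).
Proof.
move=> hh hw; set y := complex.Im z in hh hw *.
have -> : fourier_mode n (z + w + h) - fourier_mode n (z + w)
        - (fourier_mode n (z + h) - fourier_mode n z)
   = fourier_mode n z * (fourier_mode n h - 1) * (fourier_mode n w - 1).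
  by rewrite !fourier_modeD; ring.
rewrite cabsM (cabsM (fourier_mode n z)) cabs_fourier_mode -/y.
have p0 : 0 <= 2 * pi * n%:R :> R by rewrite !mulr_ge0// pi_ge0.
have hb (u : R[i]) : cabs u <= y / 4 -> cabs (fourier_mode n u - 1)
    <= 3 * (2 * pi * n%:R * cabs u) * expR (2 * pi * n%:R * (y / 4)).
  move=> hu; apply: le_trans (fourier_modeB1_le n u) _.
  by rewrite ler_wpM2l ?ler_expR ?ler_wpM2l ?(mulr_ge0 _ (mulr_ge0 _ _)) ?cabs_ge0.
have e0 := expR_ge0 (- (2 * pi * n%:R * y)).
apply: le_trans (_ : expR (- (2 * pi * n%:R * y)) *
   (3 * (2 * pi * n%:R * cabs h) * expR (2 * pi * n%:R * (y / 4))) *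
   (3 * (2 * pi * n%:R * cabs w) * expR (2 * pi * n%:R * (y / 4))) <= _).
  apply: ler_pM; rewrite ?mulr_ge0 ?cabs_ge0 ?hb//.
  by rewrite ler_wpM2l ?hb.
have -> : expR (- (n%:R * (pi * y))) = expR (- (2 * pi * n%:R * y))
   * expR (2 * pi * n%:R * (y / 4)) * expR (2 * pi * n%:R * (y / 4)).
  by rewrite -!expRD; congr expR; field.
by rewrite le_eqVlt; apply/orP; left; apply/eqP; ring.
Qed.

(** Stated for an arbitrary filter because it is applied both to partial sums of the Fourier series
    and to difference quotients. *)
Lemma cabs_cvg_le (T : Type) (F : set_system T) (FF : ProperFilter F)
    (u : T -> R[i]^o) (l : R[i]) (B : R) :
  u @ F --> (l : R[i]^o) -> (\forall x \near F, cabs (u x) <= B) -> cabs l <= B.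
Proof.
move=> /cvgrPdist_lt ul uB; apply/ler_addgt0Pl => e e0.
have e0' : (0 : R[i]) < e%:C by rewrite ltcR.
near F => x.
have h1 : `|(l : R[i]^o) - u x| < e%:C by near: x; exact: ul.
have h2 : cabs (u x) <= B by near: x.
rewrite normr_cabs ltcR in h1.
have := cabsD (l - u x) (u x); rewrite subrK => h3.
lra.
Unshelve. all: by end_near. Qed.

End Fourier.

(** * Local Lipschitz bound for the derivative of the cusp function *)

Section FourierDerivative.
Context {R : realType}.
Variables (f : R[i]^o -> R[i]^o) (c : nat -> R[i]).
Hypotheses (cP : polynomial_growth c) (fc : fourier_expansion f c).
Implicit Types z h w : R[i].

(** The linear term iz has zero second difference, so only the modes contribute. Their partial sums
    are bounded uniformly in N, and the bound passes to the limit. *)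
Lemma fourier_second_difference z : upper_half_plane z ->
  exists K : R, forall h w,
    cabs h <= complex.Im z / 4 -> cabs w <= complex.Im z / 4 ->
    cabs (f (z + w + h) - f (z + w) - (f (z + h) - f z)) <= K * (cabs h * cabs w).
Proof.
move=> z0; set y := complex.Im z; have y0 : 0 < y by exact: z0.
have [A [k cA]] := cP.
have A0 : 0 <= A.
  by have := cA 1%N isT; rewrite expr1n mulr1; apply: le_trans; exact: cabs_ge0.
(* The exponent k + 2 collects n^k from the growth of the coefficients and n^2 from the second
   difference of a mode; the decay rate is pi y. *)
have [B hB] := sum_natM_expRN_bounded k.+2 (mulr_gt0 (pi_gt0 R) y0).
exists (A * (36 * pi ^+ 2) * B) => h w hh hw.
(* Keeps the four points of the second difference in the half-plane, where the expansion holds: the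
   largest displacement, w + h, is at most y/2. *)
have Hw (u : R[i]) : cabs u <= y / 2 -> upper_half_plane (z + u).
  move=> hu; rewrite /upper_half_plane /=.
  rewrite ImD -/y; have := Im_le_cabs u; rewrite ler_norml => /andP[h1 _]. lra.
have y4 : y / 4 <= y / 2 by lra.
have wh2 : cabs (w + h) <= y / 2 by have := cabsD w h; lra.
have H1 := fc (Hw _ wh2); have H2 := fc (Hw w (le_trans hw y4)).
have H3 := fc (Hw h (le_trans hh y4)); have H4 := fc z0.
rewrite !addrA in H1.
have H := cvgB (cvgB H1 H2) (cvgB H3 H4).
apply: (@cabs_cvg_le R _ _ _ _ _ _ (H _ _ _)); apply: nearW => N /=.
pose T n := fourier_mode n (z + w + h) - fourier_mode n (z + w)
        - (fourier_mode n (z + h) - fourier_mode n z).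
rewrite [X in cabs X](_ : _ = \sum_(1 <= n < N) c n * T n); last first.
  under [RHS]eq_bigr do rewrite /T !mulrBr.
  by rewrite !sumrB /fourier_mode !fctE /=; ring.
apply: le_trans (cabs_sum _ _) _.
apply: le_trans (_ : \sum_(1 <= n < N) A * (36 * pi ^+ 2) * (cabs h * cabs w) *
    (n%:R ^+ k.+2 * expR (- (n%:R * (pi * y)))) <= _).
  rewrite big_nat [leRHS]big_nat; apply: ler_sum => n /andP[n0 _].
  rewrite cabsM.
  have := fourier_mode_second_difference n hh hw; rewrite -/(T n) -/y => hT.
  apply: le_trans (ler_pM (cabs_ge0 _) (cabs_ge0 _) (cA n n0) hT) _.
  by rewrite -[k.+2]addn2 exprD le_eqVlt; apply/orP; left; apply/eqP; ring.
rewrite -mulr_sumr -[leRHS]mulrA [B * _]mulrC [leRHS]mulrA.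
apply: ler_wpM2l (hB N).
by rewrite !mulr_ge0 ?cabs_ge0 ?pi_ge0.
Qed.

(** Divide the second difference by [h] and let [h] tend to 0: its bound is bilinear in |h| and |w|,
    so K |w| survives. The series is never differentiated term by term. *)
Lemma derive_fourier_lipschitz z :
  (forall z, upper_half_plane z -> derivable f z 1) -> upper_half_plane z ->
  exists K : R, forall w, cabs w <= complex.Im z / 4 ->
    cabs ('D_1 f (z + w) - 'D_1 f z) <= K * cabs w.
Proof.
move=> df z0; have [K hK] := fourier_second_difference z0; exists K => w hw.
have y0 : 0 < complex.Im z by exact: z0.
have zw : upper_half_plane (z + w).
  rewrite /upper_half_plane /=.
  rewrite ImD.
  have := Im_le_cabs w; rewrite ler_norml => /andP[h1 _]; lra.
have H := cvgB (df _ zw) (df _ z0).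
apply: (@cabs_cvg_le R _ _ _ _ _ _ (H _)); near=> h => /=.
have hn0 : h != 0 by near: h; exact: nbhs_dnbhs_neq.
rewrite [X in cabs X](_ : _
    = h^-1 * (f (z + w + h) - f (z + w) - (f (z + h) - f z))); last first.
  have hE : h *: (1 : R[i]^o) = h by exact: mulr1.
  by rewrite !fctE /= hE !(addrC h) mulrBr.
rewrite cabsM cabsV.
rewrite ler_pdivrMl ?lt0r ?cabs_ge0 ?cabs_eq0 ?hn0//.
rewrite mulrCA.
apply: hK => //; near: h.
have y4 : (0 : R[i]) < (complex.Im z / 4)%:C by rewrite ltcR; lra.
apply/nbhs_dnbhs/nbhs_ballP; exists (complex.Im z / 4)%:C => //= h.
by rewrite /ball /= sub0r normrN normr_cabs ltcR => /ltW.
Unshelve. all: by end_near. Qed.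

End FourierDerivative.

(** * Continuity and differentiability of paths in the complex plane *)

Section ComplexPaths.
Context {R : realType}.
Implicit Types (w v : R -> R[i]) (z : R[i]).

Definition ccontinuous w : Prop :=
  continuous (fun t => complex.Re (w t)) /\ continuous (fun t => complex.Im (w t)).

(** Taken componentwise to match [cderive] and [cintegral], which treat real and imaginary parts
    separately. *)
Definition is_cderive w (t : R) (d : R[i]) : Prop :=
  is_derive t 1 (fun u => complex.Re (w u)) (complex.Re d) /\
  is_derive t 1 (fun u => complex.Im (w u)) (complex.Im d).

Lemma is_derive_continuous (f df : R -> R) :
  (forall t : R, is_derive t 1 f (df t)) -> continuous f.
Proof.
move=> fE t; apply: differentiable_continuous.
exact/derivable1_diffP/(@ex_derive _ _ _ _ _ _ _ (fE t)).
Qed.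

Lemma is_cderive_continuous w (dw : R -> R[i]) :
  (forall t, is_cderive w t (dw t)) -> ccontinuous w.
Proof.
move=> wE; split.
  by apply: (is_derive_continuous (df := fun t => complex.Re (dw t))) => t; have [] := wE t.
by apply: (is_derive_continuous (df := fun t => complex.Im (dw t))) => t; have [] := wE t.
Qed.

Lemma ccontinuousM w v : ccontinuous w -> ccontinuous v ->
  ccontinuous (fun t => w t * v t).
Proof.
have RM (a b : R[i]) : complex.Re (a * b)
    = complex.Re a * complex.Re b - complex.Im a * complex.Im b.
  by case: a b => ? ? [].
have IM (a b : R[i]) : complex.Im (a * b)
    = complex.Re a * complex.Im b + complex.Im a * complex.Re b.
  by case: a b => ? ? [].
move=> [w1 w2] [v1 v2]; split.
  by under eq_fun do rewrite RM; move=> t; apply: cvgB; apply: cvgM; [exact: w1|exact: v1|exact: w2|exact: v2].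
by under eq_fun do rewrite IM; move=> t; apply: cvgD; apply: cvgM; [exact: w1|exact: v2|exact: w2|exact: v1].
Qed.

Lemma ccontinuousB w v : ccontinuous w -> ccontinuous v ->
  ccontinuous (fun t => w t - v t).
Proof.
have RB (a b : R[i]) : complex.Re (a - b) = complex.Re a - complex.Re b.
  by case: a b => ? ? [].
have IB (a b : R[i]) : complex.Im (a - b) = complex.Im a - complex.Im b.
  by case: a b => ? ? [].
move=> [w1 w2] [v1 v2]; split.
  by under eq_fun do rewrite RB; move=> t; apply: cvgB; [exact: w1|exact: v1].
by under eq_fun do rewrite IB; move=> t; apply: cvgB; [exact: w2|exact: v2].
Qed.

Lemma ccontinuous_cst z : ccontinuous (fun=> z).
Proof. by split=> t; exact: cvg_cst. Qed.

Lemma normc_gt0 z : z != 0 -> 0 < complex.Re z ^+ 2 + complex.Im z ^+ 2.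
Proof.
move=> z0; rewrite lt0r addr_ge0 ?sqr_ge0// andbT.
apply: contra z0; rewrite paddr_eq0 ?sqr_ge0// !sqrf_eq0.
by case: z => x y /= /andP[/eqP -> /eqP ->].
Qed.

Lemma ccontinuousV w : ccontinuous w -> (forall t, w t != 0) ->
  ccontinuous (fun t => (w t)^-1).
Proof.
have RV (a : R[i]) : complex.Re a^-1
    = complex.Re a / (complex.Re a ^+ 2 + complex.Im a ^+ 2) by case: a.
have IV (a : R[i]) : complex.Im a^-1
    = - (complex.Im a / (complex.Re a ^+ 2 + complex.Im a ^+ 2)) by case: a.
move=> [w1 w2] w0.
have w3 : continuous (fun t => (complex.Re (w t) ^+ 2 + complex.Im (w t) ^+ 2)^-1).
  move=> t; apply: cvgV; first by rewrite gt_eqF// normc_gt0.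
  by apply: cvgD; apply: cvgM; [exact: w1|exact: w1|exact: w2|exact: w2].
split.
  by under eq_fun do rewrite RV; move=> t; apply: cvgM; [exact: w1|exact: w3].
by under eq_fun do rewrite IV; move=> t; apply: cvgN; apply: cvgM; [exact: w2|exact: w3].
Qed.

Lemma cabs_cvg_near w (t : R) (e : R) : ccontinuous w -> 0 < e ->
  \forall s \near t, cabs (w s - w t) < e.
Proof.
move=> [w1 w2] e0; have e2 : 0 < e / 2 by lra.
have /cvgrPdist_lt/(_ _ e2) h1 := w1 t; have /cvgrPdist_lt/(_ _ e2) h2 := w2 t.
near=> s; apply: le_lt_trans (cabs_le _) _.
have k1 : `|complex.Re (w t) - complex.Re (w s)| < e / 2 by near: s.
have k2 : `|complex.Im (w t) - complex.Im (w s)| < e / 2 by near: s.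
move: k1 k2; rewrite distrC [X in _ -> X < _ -> _]distrC.
by case: (w s) (w t) => ? ? [] ? ? /= k1 k2; lra.
Unshelve. all: by end_near. Qed.

Lemma near_continuous_Re_Im w (t : R) :
  (forall e : R, 0 < e -> \forall s \near t, cabs (w s - w t) < e) ->
  {for t, continuous (fun s => complex.Re (w s))} /\
  {for t, continuous (fun s => complex.Im (w s))}.
Proof.
move=> h; split; apply/cvgrPdist_lt => e e0; near=> s.
  have k : cabs (w s - w t) < e by near: s; exact: h.
  rewrite distrC; apply: le_lt_trans k; apply: le_trans (Re_le_cabs _).
  by case: (w s) (w t) => ? ? [].
have k : cabs (w s - w t) < e by near: s; exact: h.
rewrite distrC; apply: le_lt_trans k; apply: le_trans (Im_le_cabs _).
by case: (w s) (w t) => ? ? [].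
Unshelve. all: by end_near. Qed.

(** Continuity of [F] is asked only at the points of the path, since the derivative of the cusp
    function is controlled only inside the half-plane. *)
Lemma ccontinuous_comp (F : R[i] -> R[i]) w : ccontinuous w ->
  (forall t e : R, 0 < e -> exists2 r : R, 0 < r &
     forall z, cabs (z - w t) < r -> cabs (F z - F (w t)) < e) ->
  ccontinuous (fun t => F (w t)).
Proof.
move=> cw hF.
have h (t e : R) : 0 < e -> \forall s \near t, cabs (F (w s) - F (w t)) < e.
  move=> e0; have [r r0 hr] := hF t e e0.
  by near=> s; apply: hr; near: s; exact: cabs_cvg_near.
by split=> t; have [] := near_continuous_Re_Im (h t).
Unshelve. all: by end_near. Qed.

(** The difference quotient, completed by the derivative at [z], is continuous there. In this form
    the chain rule involves no division by an increment of the path, which may vanish. *)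
Lemma caratheodory_complex (f : R[i]^o -> R[i]^o) z : derivable f z 1 ->
  exists Q : R[i] -> R[i],
    [/\ forall u, f u - f z = Q u * (u - z), Q z = 'D_1 f z &
        forall e : R, 0 < e -> exists2 r : R, 0 < r &
          forall u, cabs (u - z) < r -> cabs (Q u - Q z) < e].
Proof.
move=> df; exists (fun u => if u == z then 'D_1 f z else (f u - f z) / (u - z)).
split; rewrite ?eqxx//.
  move=> u; have [->|uz] := eqVneq u z; first by rewrite !subrr mulr0.
  by rewrite divfK// subr_eq0.
move=> e e0; have eC : (0 : R[i]) < e%:C by rewrite ltcR.
have /cvgrPdist_lt/(_ _ eC)/nbhs_ballP[r /= r0 hr] := df.
(* The radius of a ball of [R[i]] is itself in [R[i]]; being positive for the partial order, it is
   real. *)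
have rE : r = (complex.Re r)%:C.
  by move: r0; case: (r) => a b; rewrite ltcE /= => /andP[/eqP -> _].
have r0' : 0 < complex.Re r by rewrite -ltcR -rE.
exists (complex.Re r) => // u uz; have [uzE|uz0] := eqVneq u z.
  by rewrite subrr cabs0.
have uz1 : u - z != 0 by rewrite subr_eq0.
have := hr (u - z); rewrite /ball /= sub0r normrN normr_cabs rE ltcR => /(_ uz uz1).
rewrite distrC normr_cabs ltcR.
have -> : (u - z) *: (1 : R[i]^o) = u - z by exact: mulr1.
by rewrite subrK /GRing.scale /= mulrC.
Qed.

(** The factor [Q] of [f] along the path multiplies the factors [g1], [g2] of the two components of
    [w]; the real and imaginary parts of the product are the factors of the composite. *)
Lemma is_cderive_comp (f : R[i]^o -> R[i]^o) w (t : R) (d : R[i]) :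
  ccontinuous w -> is_cderive w t d -> derivable f (w t) 1 ->
  is_cderive (fun s => f (w s)) t ('D_1 f (w t) * d).
Proof.
move=> cw [/is_derive1_caratheodory[g1 [h1 c1 e1]] /is_derive1_caratheodory[g2 [h2 c2 e2]]].
move=> /caratheodory_complex[Q [hQ QE cQ]].
pose q s := Q (w s).
have cq (e : R) : 0 < e -> \forall s \near t, cabs (q s - q t) < e.
  move=> e0; have [r r0 hr] := cQ e e0.
  by near=> s; apply: hr; near: s; exact: cabs_cvg_near.
have [cRq cIq] := near_continuous_Re_Im cq.
have wE s : w s - w t = (g1 s * (s - t)) +i* (g2 s * (s - t)).
  by rewrite -h1 -h2; case: (w s) (w t) => ? ? [].
have fE s : f (w s) - f (w t) =
   ((complex.Re (q s) * g1 s - complex.Im (q s) * g2 s) * (s - t)) +i*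
   ((complex.Re (q s) * g2 s + complex.Im (q s) * g1 s) * (s - t)).
  rewrite hQ wE -/(q s); case: (q s) => a b.
  by apply/eqP; rewrite eq_complex /=; apply/andP; split; apply/eqP; ring.
have qt : q t = 'D_1 f (w t) by [].
split; apply/is_derive1_caratheodory.
  exists (fun s => complex.Re (q s) * g1 s - complex.Im (q s) * g2 s); split.
  - by move=> s; have := congr1 (@complex.Re R) (fE s) => /= <-; case: (f (w s)) (f (w t)) => ? ? [].
  - by apply: cvgB; apply: cvgM; [exact: cRq|exact: c1|exact: cIq|exact: c2].
  - by rewrite e1 e2 qt; case: ('D_1 f (w t)) d {e1 e2} => ? ? [].
exists (fun s => complex.Re (q s) * g2 s + complex.Im (q s) * g1 s); split.
- by move=> s; have := congr1 (@complex.Im R) (fE s) => /= <-; case: (f (w s)) (f (w t)) => ? ? [].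
- by apply: cvgD; apply: cvgM; [exact: cRq|exact: c2|exact: cIq|exact: c1].
- by rewrite e1 e2 qt; case: ('D_1 f (w t)) d {e1 e2} => ? ? [].
Unshelve. all: by end_near. Qed.

End ComplexPaths.

(** * Logarithm on the right half-plane and its relation to the principal branch *)

Section ComplexLogarithm.
Context {R : realType}.
Implicit Types (w p : R -> R[i]) (z : R[i]).

(* Agrees with the principal logarithm only where the real part is positive. *)
Definition rlog z : R[i] :=
  (ln (complex.Re z ^+ 2 + complex.Im z ^+ 2) / 2)
  +i* atan (complex.Im z / complex.Re z).

Lemma cexp_rlog z : 0 < complex.Re z -> cexp (rlog z) = z.
Proof.
case: z => x y /= x0; rewrite /rlog /cexp /=.
set N := x ^+ 2 + y ^+ 2; set r := expR _; set th := atan _.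
have N0 : 0 < N by rewrite /N; nra.
have r0 : 0 < r by exact: expR_gt0.
have rN : r ^+ 2 = N.
  by rewrite expr2 -expRD -splitr lnK// posrE.
have c0 : 0 < cos th by apply: cos_gt0_pihalf; rewrite atan_gtNpi2 atan_ltpi2.
have tE : sin th = cos th * (y / x).
  by rewrite -(atanK (y / x)) -/th /tan mulrC divfK// gt_eqF.
have x0' : x != 0 by rewrite gt_eqF.
have rc : r * cos th = x.
  have h : (r * cos th) ^+ 2 = x ^+ 2.
    have := cos2Dsin2 th; rewrite tE => h.
    by rewrite exprMn rN /N -[RHS]mulr1 -[in RHS]h; field.
  by apply/eqP; rewrite -(eqrXn2 (n := 2))// ?h// ltW// mulr_gt0.
apply/eqP; rewrite eq_complex /= tE; apply/andP; split; apply/eqP.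
  by rewrite mul0r subr0.
by rewrite mul0r addr0 !mulrA rc mulrAC divff// mul1r.
Qed.

Lemma carg_polar (r phi : R) : 0 < r -> - pi < phi -> phi <= pi ->
  carg ((r * cos phi) +i* (r * sin phi)) = phi.
Proof.
move=> r0 h1 h2; rewrite /carg /cabs /=.
have -> : Num.sqrt ((r * cos phi) ^+ 2 + (r * sin phi) ^+ 2) = r.
  rewrite !exprMn -mulrDr cos2Dsin2 mulr1 sqrtr_sqr ger0_norm// ltW//.
rewrite mulrAC divff ?gt_eqF// mul1r pmulr_rge0//.
have [p0|p0] := leP 0 phi.
  by rewrite sin_ge0_pi ?p0// cosK// in_itv /= p0.
have s0 : sin phi < 0.
  by rewrite -oppr_gt0 -sinN sin_gt0_pi// oppr_gt0 p0 ltrNl.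
rewrite leNgt s0 /= -cosN cosK ?opprK// in_itv /= oppr_ge0 ltW//= lerNl ltW//.
Qed.

(** This is the source of the sign term in the Rademacher symbol. For real z > 0 the principal
    argument of -z^2 is pi and the formula fails, whence the condition on the imaginary part. *)
Lemma clogN_sqr z : 0 < complex.Re z -> complex.Im z != 0 ->
  clog (- z ^+ 2) = 2%:C * rlog z - (0 +i* (pi * Num.sg (complex.Im z))).
Proof.
move=> x0 y0; set L := rlog z; set th := complex.Im L.
have zE : z = cexp L by rewrite cexp_rlog.
(* Negating z^2 shifts its argument 2 th by an odd multiple of pi. As th has the sign s and |th| <
   pi/2, the shift by -pi s is the one that lands in ]-pi, pi]. *)
set s := Num.sg _; set phi := 2 * th - pi * s.
have thP : - (pi / 2) < th < pi / 2 by rewrite /th /= atan_gtNpi2 atan_ltpi2.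
have /andP[thl thu] := thP; have pi0 := pi_gt0 R.
have [phiP cphi sphi] : [/\ - pi < phi <= pi, cos phi = - cos (2 * th) &
    sin phi = - sin (2 * th)].
  have [yl|yg|yE] := ltgtP (complex.Im z) 0; last by rewrite yE eqxx in y0.
    have sE : s = -1 by rewrite /s ltr0_sg.
    have th0 : th < 0.
      by rewrite -[X in _ < X]atan0; apply: lt_atan; rewrite pmulr_llt0 ?invr_gt0.
    have -> : phi = 2 * th + pi by rewrite /phi sE; ring.
    by rewrite cosDpi sinDpi; split => //; apply/andP; split; lra.
  have sE : s = 1 by rewrite /s gtr0_sg.
  have th0 : 0 < th.
    by rewrite -[X in X < _]atan0; apply: lt_atan; rewrite divr_gt0.
  have -> : phi = 2 * th - pi by rewrite /phi sE; ring.
  have hc : cos (2 * th - pi) = - cos (2 * th).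
    by rewrite -[in RHS](subrK pi (2 * th)) cosDpi opprK.
  have hs : sin (2 * th - pi) = - sin (2 * th).
    by rewrite -[in RHS](subrK pi (2 * th)) sinDpi opprK.
  by split => //; apply/andP; split; lra.
set r := expR (2 * complex.Re L).
have wE : - z ^+ 2 = (r * cos phi) +i* (r * sin phi).
  rewrite zE -cexpMn cphi sphi.
  have -> : L *+ 2 = (2 * complex.Re L) +i* (2 * th).
    by rewrite /th mulr2n; case: (L) => a b; apply/eqP; rewrite eq_complex /= !mulr_natl !mulr2n !eqxx.
  by rewrite /cexp /= -/r; apply/eqP; rewrite eq_complex /=; apply/andP; split; apply/eqP; ring.
have r0 : 0 < r by exact: expR_gt0.
have /andP[p1 p2] := phiP.
rewrite /clog wE carg_polar// {1}/cabs /= !exprMn -mulrDr cos2Dsin2 mulr1.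
rewrite sqrtr_sqr ger0_norm ?ltW// expRK.
by apply/eqP; rewrite eq_complex /=; apply/andP; split; apply/eqP; rewrite /phi /th /=; ring.
Qed.

Lemma is_cderive_rlog p (t : R) (d : R[i]) : 0 < complex.Re (p t) ->
  is_cderive p t d -> is_cderive (fun s => rlog (p s)) t (d / p t).
Proof.
move=> x0 [hx hy].
set x := (fun u => complex.Re (p u)) in hx; set y := (fun u => complex.Im (p u)) in hy.
set x' := complex.Re d in hx; set y' := complex.Im d in hy.
have N0 : 0 < x t * x t + y t * y t by rewrite /x; nra.
have xt0 : x t != 0 by rewrite gt_eqF.
have Nt0 : x t ^+ 2 + y t ^+ 2 != 0 by rewrite !expr2 gt_eqF.
have hN := is_deriveD (is_deriveM hx hx) (is_deriveM hy hy).
have hl := @is_derive1_comp R (@ln R) (x * x + y * y) t _ _ (is_derive1_ln N0) hN.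
have hv := is_deriveM hy (is_deriveV xt0 hx).
have ha := @is_derive1_comp R (@atan R) (y * (fun u => (x u)^-1)) t _ _ (is_derive1_atan _) hv.
have E : d / p t = ((x' * x t + y' * y t) / (x t ^+ 2 + y t ^+ 2)) +i*
    ((y' * x t - x' * y t) / (x t ^+ 2 + y t ^+ 2)).
  rewrite /x' /y' /x /y in Nt0 *; case: (d) (p t) Nt0 => a b [a' b'] /= nz.
  by apply/eqP; rewrite eq_complex /=; apply/andP; split; apply/eqP; field.
split; rewrite E /=.
  have := is_deriveM hl (is_derive_cst (2^-1 : R) t 1).
  set dd := (X in is_derive _ _ _ X).
  have -> : dd = (x' * x t + y' * y t) / (x t ^+ 2 + y t ^+ 2).
    rewrite /dd /= /GRing.scale /=; field.
    by [].
  move=> H; apply: (eq_ind _ (fun g : R -> R => is_derive t 1 g _) H).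
by apply/funext => u; rewrite /= !expr2.
move: ha; set dd := (X in is_derive _ _ _ X).
have -> : dd = (y' * x t - x' * y t) / (x t ^+ 2 + y t ^+ 2).
  rewrite /dd !fctE /GRing.scale /=; field.
  by rewrite xt0 Nt0.
by [].
Qed.

Lemma is_cderive_cexp p (t : R) (d C : R[i]) : is_cderive p t d ->
  is_cderive (fun s => C * cexp (p s)) t (C * cexp (p t) * d).
Proof.
move=> [hx hy].
set x := (fun u => complex.Re (p u)) in hx; set y := (fun u => complex.Im (p u)) in hy.
have he := @is_derive1_comp R (@expR R) x t _ _ (is_derive_expR _) hx.
have hc := is_deriveM he (@is_derive1_comp R (@cos R) y t _ _ (is_derive_cos _) hy).
have hs := is_deriveM he (@is_derive1_comp R (@sin R) y t _ _ (is_derive_sin _) hy).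
case: C => a b; case: d hx hy he hc hs => x' y' hx hy he hc hs.
split.
  have := is_deriveB (is_deriveM (is_derive_cst a t 1) hc) (is_deriveM (is_derive_cst b t 1) hs).
  set dd := (X in is_derive _ _ _ X).
  have -> : dd = complex.Re ((a +i* b) * cexp (p t) * (x' +i* y')).
    by rewrite /dd /cexp /= /GRing.scale /= -/(x t) -/(y t); ring.
  move=> H; apply: (eq_ind _ (fun g : R -> R => is_derive t 1 g _) H).
by apply/funext => u; rewrite !fctE /cexp /= -/(x u) -/(y u); ring.
have := is_deriveD (is_deriveM (is_derive_cst a t 1) hs) (is_deriveM (is_derive_cst b t 1) hc).
set dd := (X in is_derive _ _ _ X).
have -> : dd = complex.Im ((a +i* b) * cexp (p t) * (x' +i* y')).
  by rewrite /dd /cexp /= /GRing.scale /= -/(x t) -/(y t); ring.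
move=> H; apply: (eq_ind _ (fun g : R -> R => is_derive t 1 g _) H).
by apply/funext => u; rewrite !fctE /cexp /= -/(x u) -/(y u); ring.
Qed.

End ComplexLogarithm.

(** * The index as an increment of a logarithm *)

Section IndexAlongPath.
Context {R : realType}.
Implicit Types (w v P : R -> R[i]) (z : R[i]).

Lemma is_cderiveB w v (t : R) (dw dv : R[i]) :
  is_cderive w t dw -> is_cderive v t dv ->
  is_cderive (fun s => w s - v s) t (dw - dv).
Proof.
move=> [h1 h2] [k1 k2]; split.
  have := is_deriveB h1 k1; case: dw dv {h1 h2 k1 k2} => a b [a' b'] H.
  apply: (eq_ind _ (fun g : R -> R => is_derive t 1 g _) H); apply/funext => s.
  by rewrite !fctE; case: (w s) (v s) => ? ? [].
have := is_deriveB h2 k2; case: dw dv {h1 h2 k1 k2} => a b [a' b'] H.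
apply: (eq_ind _ (fun g : R -> R => is_derive t 1 g _) H); apply/funext => s.
by rewrite !fctE; case: (w s) (v s) => ? ? [].
Qed.

Lemma is_cderiveZ (r : R) w (t : R) (dw : R[i]) : is_cderive w t dw ->
  is_cderive (fun s => r%:C * w s) t (r%:C * dw).
Proof.
move=> [h1 h2]; split.
  have := is_deriveZ r h1; case: dw {h1 h2} => a b H.
  have -> : complex.Re (r%:C * (a +i* b)) = r * a by rewrite /= mul0r subr0.
  apply: (eq_ind _ (fun g : R -> R => is_derive t 1 g _) H); apply/funext => s.
  by rewrite /=; case: (w s) => x y; rewrite /= mul0r subr0.
have := is_deriveZ r h2; case: dw {h1 h2} => a b H.
have -> : complex.Im (r%:C * (a +i* b)) = r * b by rewrite /= mul0r addr0.
apply: (eq_ind _ (fun g : R -> R => is_derive t 1 g _) H); apply/funext => s.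
by rewrite /=; case: (w s) => x y; rewrite /= mul0r addr0.
Qed.

Lemma Rintegral_derive (F h : R -> R) (l : R) : 0 < l ->
  (forall t : R, is_derive t 1 F (h t)) -> continuous h ->
  (\int[lebesgue_measure]_(t in `[0%R, l]) h t)%R = F l - F 0.
Proof.
move=> l0 hF ch; have cF := is_derive_continuous hF.
rewrite /Rintegral (@continuous_FTC2 R h F 0 l)//.
- by apply: continuous_subspaceT.
- split.
  + by move=> t _; exact: (@ex_derive _ _ _ _ _ _ _ (hF t)).
  + by apply: cvg_at_right_filter; exact: cF.
  + by apply: cvg_at_left_filter; exact: cF.
- by move=> t _; rewrite derive1E (@derive_val _ _ _ _ _ _ _ (hF t)).
Qed.

Lemma cintegral_cderive P (h : R -> R[i]) (l : R) : 0 < l ->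
  (forall t, is_cderive P t (h t)) -> ccontinuous h ->
  cintegral 0 l h = P l - P 0.
Proof.
move=> l0 hP [c1 c2]; rewrite /cintegral.
rewrite (Rintegral_derive l0 (fun t => (hP t).1) c1).
rewrite (Rintegral_derive l0 (fun t => (hP t).2) c2).
by case: (P l) (P 0) => ? ? [].
Qed.

(** The logarithmic derivative of C exp(P) is exactly P' = [h], so the constant cancels; continuity
    of [h] is what the fundamental theorem of calculus requires. *)
Lemma index_along_cexp (F : 'M[R]_2 -> R[i]) (g : 'M[R]_2) (l : R) (C : R[i])
    P (h : R -> R[i]) : 0 < l -> C != 0 ->
  (forall t, F (geodesic_flow g t) = C * cexp (P t)) ->
  (forall t, is_cderive P t (h t)) -> ccontinuous h ->
  index_along F g l = ((2 * pi)%:C * 'i%C)^-1 * (P l - P 0).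
Proof.
move=> l0 C0 FE hP ch; rewrite -(cintegral_cderive l0 hP ch) /index_along.
congr (_ * cintegral _ _ _); apply/funext => t /=.
have -> : (fun u => F (geodesic_flow g u)) = (fun u => C * cexp (P u)).
  by apply/funext => u; rewrite FE.
have [k1 k2] := is_cderive_cexp C (hP t).
have -> : cderive (fun u => C * cexp (P u)) t = C * cexp (P t) * h t.
  rewrite /cderive !derive1E (@derive_val _ _ _ _ _ _ _ k1) (@derive_val _ _ _ _ _ _ _ k2).
  by case: (_ * h t).
by rewrite FE mulrC mulKf// mulf_neq0// cexp_neq0.
Qed.

End IndexAlongPath.

(** * A family of functions closed under differentiation *)

Section ExponentialSums.
Context {R : realType}.
Implicit Types a b k t : R.

(** The components of [orbit_factor] have this form with [k] = 1/2, the numerator and denominator of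
    [orbit_point] with [k] = 1. *)
Definition expsum a b k t : R := a * expR (k * t) + b * expR (- (k * t)).

Lemma is_derive_expsum a b k t :
  is_derive t 1 (expsum a b k) (expsum (k * a) (- (k * b)) k t).
Proof.
have hk := is_deriveZ k (is_derive_id t 1).
have h1 := @is_derive1_comp R (@expR R) (k *: id) t _ _ (is_derive_expR _) hk.
have h2 := @is_derive1_comp R (@expR R) (- (k *: id)) t _ _ (is_derive_expR _) (is_deriveN hk).
have := is_deriveD (is_deriveZ a h1) (is_deriveZ b h2).
set dd := (X in is_derive _ _ _ X).
have -> // : dd = expsum (k * a) (- (k * b)) k t.
by rewrite /dd /expsum !fctE /GRing.scale /=; ring.
Qed.

Lemma continuous_expsum a b k : continuous (expsum a b k).
Proof. exact: is_derive_continuous (is_derive_expsum a b k). Qed.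

Lemma expsum_gt0 a b k t : 0 <= a -> 0 <= b -> 0 < a + b -> 0 < expsum a b k t.
Proof.
move=> a0 b0; rewrite /expsum => ab.
have ea := expR_gt0 (k * t); have eb := expR_gt0 (- (k * t)).
have [a1|a1] := ltP 0 a; first by nra.
have -> : a = 0 by lra.
by rewrite mul0r add0r mulr_gt0//; lra.
Qed.

End ExponentialSums.

(** * Matrices of size 2, the cocycle relation, and the entries of the geodesic flow *)

Section FlowOrbit.
Context {R : realType}.
Implicit Types (g h gamma : 'M[R]_2) (z : R[i]) (t : R).

Lemma det_mx2 g : \det g = g 0 0 * g 1 1 - g 0 1 * g 1 0.
Proof.
have l00 : lift 0 0 = 1 :> 'I_2 by exact/val_inj.
have l10 : lift 1 0 = 0 :> 'I_2 by exact/val_inj.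
rewrite (expand_det_row _ 0) !big_ord_recl big_ord0 /cofactor !det_mx11 !mxE.
by rewrite !l00 !l10 /= expr0 expr1; ring.
Qed.

Lemma mulmx2 g h (i j : 'I_2) : (g *m h) i j = g i 0 * h 0 j + g i 1 * h 1 j.
Proof.
have l00 : lift 0 0 = 1 :> 'I_2 by exact/val_inj.
by rewrite mxE !big_ord_recl big_ord0 l00 addr0.
Qed.

Lemma mxtrace2 g : \tr g = g 0 0 + g 1 1.
Proof.
have l00 : lift 0 0 = 1 :> 'I_2 by exact/val_inj.
by rewrite /mxtrace !big_ord_recl big_ord0 l00 addr0.
Qed.

Lemma jfactorM g h z : jfactor h z != 0 ->
  jfactor (g *m h) z = jfactor g (mobius h z) * jfactor h z.
Proof.
move=> hz; rewrite /mobius {1 2}/jfactor mulrDl -mulrA divfK// !mulmx2 /jfactor.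
by rewrite !rmorphD !rmorphM /=; ring.
Qed.

Lemma mobiusM g h z : jfactor h z != 0 ->
  mobius (g *m h) z = mobius g (mobius h z).
Proof.
move=> hz; rewrite {1}/mobius jfactorM// {2}/mobius.
have -> : ((g *m h) 0 0)%:C * z + ((g *m h) 0 1)%:C
    = ((g 0 0)%:C * mobius h z + (g 0 1)%:C) * jfactor h z.
  rewrite mulrDl -mulrA divfK// !mulmx2 /jfactor.
  by rewrite !rmorphD !rmorphM /=; ring.
by rewrite invfM mulrACA divff// mulr1.
Qed.

Lemma geodesic_flow_col0 g t (i : 'I_2) :
  geodesic_flow g t i 0 = g i 0 * expR (2^-1 * t).
Proof. by rewrite mulmx2 !mxE /= mulrC [t / 2]mulrC; ring. Qed.

Lemma geodesic_flow_col1 g t (i : 'I_2) :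
  geodesic_flow g t i 1 = g i 1 * expR (- (2^-1 * t)).
Proof. by rewrite mulmx2 !mxE /= mulNr [t / 2]mulrC; ring. Qed.

End FlowOrbit.

(** * The flow orbit of i in coordinates *)

Section FlowOrbitPoint.
Context {R : realType}.
Variables (g : 'M[R]_2) (detg : \det g = 1).
Implicit Types t : R.

(** Multiplying numerator and denominator of g a_t i by the conjugate of j(g a_t, i) gives real part
    [num] and imaginary part det g = 1 over [den] = |j(g a_t, i)|^2. *)
Let num := expsum (g 1 0 * g 0 0) (g 1 1 * g 0 1) 1.
Let den := expsum (g 1 0 ^+ 2) (g 1 1 ^+ 2) 1.
Let num' := expsum (1 * (g 1 0 * g 0 0)) (- (1 * (g 1 1 * g 0 1))) 1.
Let den' := expsum (1 * g 1 0 ^+ 2) (- (1 * g 1 1 ^+ 2)) 1.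

Definition orbit_point t : R[i] := (num t / den t) +i* (den t)^-1.

Definition orbit_point' t : R[i] :=
  ((num' t * den t - num t * den' t) / den t ^+ 2) +i* - (den' t / den t ^+ 2).

(* [j(g a_t, i)] times the conjugate of [j(g, i)]; the point of this
   normalization is that it stays in the right half-plane. *)
Definition orbit_factor t : R[i] :=
  expsum (g 1 0 ^+ 2) (g 1 1 ^+ 2) 2^-1 t
  +i* expsum (g 1 0 * g 1 1) (- (g 1 0 * g 1 1)) 2^-1 t.

(** The coefficients are left unsimplified so that [is_derive_expsum] applies literally. *)
Definition orbit_factor' t : R[i] :=
  expsum (2^-1 * g 1 0 ^+ 2) (- (2^-1 * g 1 1 ^+ 2)) 2^-1 t
  +i* expsum (2^-1 * (g 1 0 * g 1 1)) (- (2^-1 * - (g 1 0 * g 1 1))) 2^-1 t.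

Lemma bottom_row_gt0 : 0 < g 1 0 ^+ 2 + g 1 1 ^+ 2.
Proof.
rewrite lt0r addr_ge0 ?sqr_ge0// andbT paddr_eq0 ?sqr_ge0// !sqrf_eq0.
apply/negP => /andP[/eqP c0 /eqP d0]; have := detg.
by rewrite det_mx2 c0 d0 !mulr0 subrr => /eqP; rewrite eq_sym oner_eq0.
Qed.

Let den_gt0 t : 0 < den t.
Proof. by rewrite expsum_gt0 ?sqr_ge0// bottom_row_gt0. Qed.

Lemma orbit_factor_Re_gt0 t : 0 < complex.Re (orbit_factor t).
Proof. by rewrite expsum_gt0 ?sqr_ge0// bottom_row_gt0. Qed.

Lemma orbit_point_upper t : upper_half_plane (orbit_point t).
Proof. by rewrite /upper_half_plane /= invr_gt0. Qed.

Let halfE t : (expR (1 * t) = expR (2^-1 * t) ^+ 2) *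
  (expR (- (1 * t)) = expR (- (2^-1 * t)) ^+ 2).
Proof. by split; rewrite expr2 -expRD; congr expR; field. Qed.

Lemma jfactor_flow t :
  jfactor (geodesic_flow g t) 'i%C * (g 1 1 +i* - g 1 0) = orbit_factor t.
Proof.
rewrite /jfactor geodesic_flow_col0 geodesic_flow_col1 /orbit_factor /expsum.
by apply/eqP; rewrite eq_complex /=; apply/andP; split; apply/eqP; ring.
Qed.

Lemma jfactor_flow_neq0 t : jfactor (geodesic_flow g t) 'i%C != 0.
Proof.
apply/negP => /eqP h; have := orbit_factor_Re_gt0 t.
by rewrite -jfactor_flow h mul0r ltxx.
Qed.

Lemma mobius_flow t : mobius (geodesic_flow g t) 'i%C = orbit_point t.
Proof.
rewrite /mobius /jfactor !geodesic_flow_col0 !geodesic_flow_col1 /orbit_point.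
have := den_gt0 t; rewrite /den /num /expsum !halfE.
set A := expR (2^-1 * t); set B := expR (- (2^-1 * t)).
have D : (g 0 0 * g 1 1 - g 0 1 * g 1 0) * (A * B) = 1.
  by rewrite -det_mx2 detg mul1r /A /B expRxMexpNx_1.
move: (g 0 0) (g 0 1) (g 1 0) (g 1 1) D => a b c d D q0.
have q0' : (d * B) ^+ 2 + (c * A) ^+ 2 != 0.
  by rewrite !exprMn addrC gt_eqF.
have mE (x y : R) : (x * A)%:C * 'i%C + (y * B)%:C = (y * B) +i* (x * A).
  by apply/eqP; rewrite eq_complex /=; apply/andP; split; apply/eqP; ring.
rewrite !mE; apply/eqP; rewrite eq_complex /= !exprMn; apply/andP.
rewrite (addrC (c ^+ 2 * _)).
split; apply/eqP; first by field; exact: q0'.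
(* The 1 in the imaginary part is restored as det g times e^(t/2) e^(-t/2), which makes the claim a
   rational identity. *)
by rewrite -[RHS]mul1r -[in RHS]D; field; exact: q0'.
Qed.

Lemma is_cderive_orbit_factor t : is_cderive orbit_factor t (orbit_factor' t).
Proof. by split; exact: is_derive_expsum. Qed.

Lemma is_cderive_orbit_point t : is_cderive orbit_point t (orbit_point' t).
Proof.
have d0 : den t != 0 by rewrite gt_eqF.
have hn : is_derive t 1 num (num' t) := is_derive_expsum _ _ _ t.
have hd : is_derive t 1 den (den' t) := is_derive_expsum _ _ _ t.
have hv := is_deriveV d0 hd.
split.
  apply: (is_derive_eq (is_deriveM hn hv)); rewrite /GRing.scale /=; field.
  by [].
by apply: (is_derive_eq hv); rewrite /GRing.scale /=; field.
Qed.

Lemma ccontinuous_orbit_factor' : ccontinuous orbit_factor'.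
Proof. by split; exact: continuous_expsum. Qed.

Lemma ccontinuous_orbit_point' : ccontinuous orbit_point'.
Proof.
have c1 : continuous num := @continuous_expsum R _ _ _.
have c2 : continuous den := @continuous_expsum R _ _ _.
have c3 : continuous num' := @continuous_expsum R _ _ _.
have c4 : continuous den' := @continuous_expsum R _ _ _.
have c5 : continuous (fun t => (den t ^+ 2)^-1).
  move=> t; apply: cvgV; first by rewrite gt_eqF// exprn_gt0.
  by apply: cvgM; exact: c2.
split=> t /=.
  apply: cvgM; last exact: c5.
  by apply: cvgB; apply: cvgM; [exact: c3|exact: c2|exact: c1|exact: c4].
by apply: cvgN; apply: cvgM; [exact: c4|exact: c5].
Qed.

End FlowOrbitPoint.

(** * Index of the lifted form along a closed geodesic *)

Section MainResult.
Context {R : realType}.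
Variables (G : set 'M[R]_2) (V : R) (f : R[i]^o -> R[i]^o).
Implicit Types (g gamma : 'M[R]_2) (w : R -> R[i]) (z : R[i]) (l t : R).

Lemma translation_trace (n : int) : \tr (translation n : 'M[R]_2) = 2.
Proof. by rewrite mxtrace2 !mxE /= !mulr0 !addr0. Qed.

(** Otherwise [gamma] would fix the cusp, hence be a translation up to sign, with trace of absolute
    value 2. *)
Lemma hyperbolic_bottom_left_neq0 gamma : normalized_cusp_oo G ->
  prime_hyperbolic G gamma -> gamma 1 0 != 0.
Proof.
move=> hG [Gg tr2 _ _]; apply/negP => /eqP c0.
have : stabilizer_oo G gamma by [].
rewrite hG => -[[n gE]|[_ [n gE]]]; move: tr2; rewrite gE.
  by rewrite translation_trace ger0_norm ?ltxx.
by rewrite linearN /= translation_trace normrN ger0_norm ?ltxx.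
Qed.

Lemma rlog_scale (r : R) z : 0 < r -> 0 < complex.Re z ->
  rlog (r%:C * z) = (ln r)%:C + rlog z.
Proof.
case: z => x y r0 /= x0; rewrite /rlog /= !mul0r subr0 addr0.
have N0 : 0 < x ^+ 2 + y ^+ 2 by nra.
have r0' : r != 0 by rewrite gt_eqF.
have -> : (r * x) ^+ 2 + (r * y) ^+ 2 = r ^+ 2 * (x ^+ 2 + y ^+ 2) by ring.
rewrite lnM ?posrE ?exprn_gt0// lnXn//.
have -> : r * y / (r * x) = y / x by rewrite -mulf_div divff// mul1r.
by apply/eqP; rewrite eq_complex /= add0r eqxx andbT; apply/eqP; field.
Qed.

Lemma ccontinuous_derive_comp w :
  (forall z, upper_half_plane z -> derivable f z 1) ->
  (exists2 c, polynomial_growth c & fourier_expansion f c) ->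
  ccontinuous w -> (forall t, upper_half_plane (w t)) ->
  ccontinuous (fun t => 'D_1 f (w t) : R[i]).
Proof.
move=> df [c cP fc] cw wH.
apply: (@ccontinuous_comp R (fun z => 'D_1 f z) _ cw) => t e e0.
have [K hK] := derive_fourier_lipschitz cP fc df (wH t).
have y0 : 0 < complex.Im (w t) by exact: wH.
have K1 : 0 < `|K| + 1 by have := normr_ge0 K; lra.
(* The first bound gives access to the Lipschitz estimate, the second makes it smaller than [e]; |K|
   + 1 replaces [K], whose sign is unknown. *)
exists (Num.min (complex.Im (w t) / 4) (e / (`|K| + 1))).
  by rewrite lt_min !divr_gt0.
move=> z; rewrite lt_min => /andP[z1 z2].
have := hK (z - w t) (ltW z1); rewrite (addrC (w t)) subrK => /le_lt_trans; apply.
apply: le_lt_trans (_ : (`|K| + 1) * cabs (z - w t) < _).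
  rewrite ler_wpM2r ?cabs_ge0//; have := ler_norm K; lra.
by rewrite mulrC -ltr_pdivlMr.
Qed.

(** Since j(g a_t, i) is [orbit_factor] divided by the constant conjugate of j(g, i), its power -2
    splits into the square of that constant and exp(-2 [rlog]), with an exponent defined along the
    whole orbit. *)
Lemma triangle_lift_orbit g t : \det g = 1 ->
  triangle_lift V f 2 (geodesic_flow g t) = (g 1 1 +i* - g 1 0) ^+ 2
    * cexp (V%:C * f (orbit_point g t) - 2%:C * rlog (orbit_factor g t)).
Proof.
move=> detg; rewrite /triangle_lift /triangle mobius_flow// cexpD cexpN.
have -> : 2%:R * V / 2 = V by field.
have -> : (2%:C : R[i]) * rlog (orbit_factor g t) = rlog (orbit_factor g t) *+ 2.
  by rewrite rmorphMn /= mulr_natl.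
rewrite cexpMn cexp_rlog ?orbit_factor_Re_gt0// -jfactor_flow.
have J0 : g 1 1 +i* - g 1 0 != 0.
  apply/negP => /eqP h; have := orbit_factor_Re_gt0 detg t.
  by rewrite -jfactor_flow h mulr0 ltxx.
have j0 := jfactor_flow_neq0 detg t; rewrite exprMn.
move: (jfactor _ _) (g 1 1 +i* _) (cexp _) j0 J0 => j J E j0 J0.
by field; rewrite j0 J0.
Qed.

Lemma index_along_triangle g l : cusp_function V f G -> \det g = 1 -> 0 < l ->
  index_along (triangle_lift V f 2) g l = ((2 * pi)%:C * 'i%C)^-1
    * (V%:C * (f (orbit_point g l) - f (orbit_point g 0))
       - 2%:C * (rlog (orbit_factor g l) - rlog (orbit_factor g 0))).
Proof.
move=> [df fourier _ _] detg l0.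
have zH := orbit_point_upper detg.
have p0 t : orbit_factor g t != 0.
  apply/negP => /eqP h; have := orbit_factor_Re_gt0 detg t.
  by rewrite h ltxx.
have dz := is_cderive_orbit_point detg; have dp := is_cderive_orbit_factor g.
have cz := is_cderive_continuous dz; have cp := is_cderive_continuous dp.
pose h t : R[i] := V%:C * ('D_1 f (orbit_point g t) * orbit_point' g t)
  - 2%:C * (orbit_factor' g t / orbit_factor g t).
rewrite (@index_along_cexp R _ _ _ ((g 1 1 +i* - g 1 0) ^+ 2) _ h l0 _
  (fun t => triangle_lift_orbit t detg)).
- by congr (_ * _); ring.
- apply: expf_neq0; apply/negP => /eqP J0; have := orbit_factor_Re_gt0 detg 0.
  by rewrite -jfactor_flow J0 mulr0 ltxx.
- move=> t; apply: is_cderiveB; apply: is_cderiveZ.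
    by apply: is_cderive_comp => //; exact: df.
  by apply: is_cderive_rlog => //; exact: orbit_factor_Re_gt0.
(* Continuity of [h]: the term with ['D_1 f] rests on the Lipschitz bound drawn from the Fourier
   expansion, the other on explicit exponential sums. *)
apply: ccontinuousB; apply: ccontinuousM (ccontinuous_cst _) _.
  apply: ccontinuousM; last exact: ccontinuous_orbit_point'.
  exact: ccontinuous_derive_comp.
apply: ccontinuousM; first exact: ccontinuous_orbit_factor'.
exact: ccontinuousV.
Qed.

End MainResult.

Theorem theorem6p3 (R : realType) (G : set 'M[R]_2) (V : R)
    (f : R[i]^o -> R[i]^o)
    (hG : cofinite_fuchsian G V) (hf : cusp_function V f G)
    (hPsi : forall gamma, G gamma -> exists q : rat, Psi V f gamma = ratr q) :
  exists k : nat, [/\ (0 < k)%N, ~~ odd k &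
    forall gamma : 'M[R]_2, prime_hyperbolic G gamma ->
    forall (g : 'M[R]_2) (l : R), geodesic_lift gamma g l ->
      index_along (triangle_lift V f k) g l
      = (k%:R * V / (4 * pi) * Psi V f gamma)%:C].
Proof.
exists 2%N; split => // gamma hgamma g l [detg l0 flow_l].
rewrite (index_along_triangle hf)//.
have [[detG _ _ _ _] _ [V0 _] cusp] := hG.
have c0 := hyperbolic_bottom_left_neq0 cusp hgamma.
have [Gg _ tr0 _] := hgamma; have [_ _ _ Phi_cst] := hf.
have V0' : V != 0 by rewrite gt_eqF.
have pi0 : (pi : R) != 0 by rewrite gt_eqF// pi_gt0.
pose z0 := orbit_point g 0; have z0H : upper_half_plane z0 by exact: orbit_point_upper.
pose J := jfactor gamma z0.
have flow0 : geodesic_flow g 0 = g.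
  apply/matrixP => i j; have [->|->] : j = 0 \/ j = 1.
    by case: j => -[|[|//]] ?; [left|right]; exact: val_inj.
    by rewrite geodesic_flow_col0 mulr0 expR0 mulr1.
  by rewrite geodesic_flow_col1 mulr0 oppr0 expR0 mulr1.
have jg0 : jfactor g 'i%C != 0 by have := jfactor_flow_neq0 detg 0; rewrite flow0.
have z0E : z0 = mobius g 'i%C by rewrite /z0 -mobius_flow// flow0.
have zl : orbit_point g l = mobius gamma z0.
  by rewrite -mobius_flow// flow_l mobiusM// -z0E.
pose r := g 1 0 ^+ 2 + g 1 1 ^+ 2.
have r0 : 0 < r by exact: bottom_row_gt0.
have p0 : orbit_factor g 0 = r%:C.
  by rewrite /orbit_factor /expsum !mulr0 oppr0 expR0 !mulr1 subrr.
(* The cocycle relation at gamma g. As r > 0, it also places J in the right half-plane, as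
   [clogN_sqr] demands. *)
have pl : orbit_factor g l = r%:C * J.
  rewrite -jfactor_flow flow_l jfactorM// -z0E -/J -p0 -jfactor_flow flow0.
  by rewrite -mulrA mulrC.
have J0 : 0 < complex.Re J.
  have := orbit_factor_Re_gt0 detg l; rewrite pl.
  by case: (J) => x y /=; rewrite mul0r subr0 pmulr_rgt0.
have ImJ : complex.Im J = gamma 1 0 * complex.Im z0.
  by rewrite /J /jfactor; case: (z0) => x y /=; ring.
have y0 : 0 < complex.Im z0 by exact: z0H.
have sJ : Num.sg (complex.Im J) = Num.sg (gamma 1 0).
  by rewrite ImJ sgrM (gtr0_sg y0) mulr1.
(* The positive trace reduces the sign in [Psi] to the sign of c, which is also that of Im J. *)
have sc : Num.sg (gamma 1 0 * (gamma 0 0 + gamma 1 1)) = Num.sg (gamma 1 0).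
  by rewrite -mxtrace2 sgrM (gtr0_sg tr0) mulr1.
have ImJ0 : complex.Im J != 0 by rewrite ImJ mulf_neq0// gt_eqF.
(* The definition of [PhiC] solved for the increment of [f], with sign(c)^2 = 1 and the principal
   logarithm replaced by [rlog J]. *)
have fE : f (mobius gamma z0) - f z0 = 'i%C * (Phi V f gamma)%:C
    + V^-1%:C * (2%:C * rlog J - (0 +i* (pi * Num.sg (gamma 1 0)))).
  have i0 : ('i%C : R[i]) != 0 by rewrite -cabs_eq0 cabs_i oner_eq0.
  rewrite -(Phi_cst gamma z0 Gg z0H) /PhiC -/J mulrA divff// mul1r.
  rewrite clogN_sqr// sJ sqr_sg c0 mulr1.
  by rewrite subrK.
rewrite zl fE p0 pl rlog_scale//.
have rlogr : rlog (r%:C) = (ln r)%:C.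
  have := @rlog_scale R r 1 r0 ltr01; rewrite mulr1 => ->.
  by rewrite /rlog /= expr1n expr0n addr0 ln1 !mul0r atan0 addr0.
rewrite rlogr /Psi sc.
move: (rlog J) (Phi V f gamma) (Num.sg (gamma 1 0)) => L phi s.
(* Both ln r and the logarithm of J cancel; what is left is i V [Psi], and division by 2 pi i gives
   V / (2 pi) = 2 V / (4 pi) times [Psi]. *)
have -> : V%:C * ('i%C * phi%:C + V^-1%:C * (2%:C * L - (0 +i* (pi * s))))
    - 2%:C * ((ln r)%:C + L - (ln r)%:C) = 'i%C * (V * phi - pi * s)%:C.
  rewrite mulrDr [V%:C * (V^-1%:C * _)]mulrA -rmorphM /= divff// mul1r.
  rewrite (addrC (ln r)%:C) addrK.
  by case: L => a b; apply/eqP; rewrite eq_complex /=; apply/andP; split; apply/eqP; ring.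
rewrite invfM mulrA -(mulrA _ 'i%C^-1) mulVf ?mulr1; last first.
  by rewrite -cabs_eq0 cabs_i oner_eq0.
by rewrite -fmorphV -rmorphM /=; congr (_%:C); move: (pi : R) pi0 => q q0; field; rewrite V0' q0.
Qed.
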